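(* Let $F:\mathbb{R}^p\to\mathbb{R}^p$ be single-valued and $L$-Lipschitz continuous ($L>0$), let $T:\mathbb{R}^p\rightrightarrows 2^{\mathbb{R}^p}$ be possibly multivalued, and assume that $F+T$ is $\rho$-co-hypomonotone with $\rho\ge0$ and $2\sqrt{34}L\rho<1$, and that $\mathrm{zer}(F+T)\ne\emptyset$. Let $\eta:=\frac1L\sqrt{\frac2{17}}$, and let $\{(x^k,y^k)\}$ (together with $\xi^k\in Tx^k$) be generated by the scheme (PEAG) described in the context, using $$\tau_k:=\frac1{k+2},\qquad \beta_k:=\frac{4\rho(1-\tau_k)}{1+\tau_k},\qquad \hat\eta_k:=(1-\tau_k)\eta.$$ Then, for all $k\ge0$ and any $x^\star\in\mathrm{zer}(F+T)$, $$\|Fx^k+\xi^k\|^2\le\frac1{(k+1)^2}\left[\frac4{(\eta-4\rho)^2}\|x^0-x^\star\|^2+\frac{2(3\eta-2\rho)}{3(\eta-4\rho)}\|Fx^0+\xi^0\|^2\right],$$ where $\xi^k\in Tx^k$ and $\xi^0\in Tx^0$. Consequently, if $J_{\eta T}$ is nonexpansive, then $$\|\mathcal{G}_\eta x^k\|^2\le\frac1{(k+1)^2}\left[\frac4{(\eta-4\rho)^2}\|x^0-x^\star\|^2+\frac{2(3\eta-2\rho)}{3(\eta-4\rho)}\|Fx^0+\xi^0\|^2\right].$$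
   Context: $\mathbb{R}^p$ carries the standard inner product $\langle\cdot,\cdot\rangle$ and Euclidean norm $\|\cdot\|$. A (possibly multivalued) operator $G$ on $\mathbb{R}^p$ is $\rho$-co-hypomonotone if $\langle u-v,x-y\rangle\ge-\rho\|u-v\|^2$ for all $x,y$ and all $u\in Gx$, $v\in Gy$ (for $\rho=0$ this is monotonicity). $\mathrm{zer}(F+T):=\{x: 0\in Fx+Tx\}$. The resolvent is $J_{\eta T}u:=\{x\in\mathbb{R}^p: u\in x+\eta Tx\}$. ''$J_{\eta T}$ is nonexpansive'' means that $J_{\eta T}$ is a single-valued map $\mathbb{R}^p\to\mathbb{R}^p$ that is $1$-Lipschitz. In that case the residual operator is $\mathcal{G}_\eta x:=\frac1\eta\big(x-J_{\eta T}(x-\eta Fx)\big)$. Scheme (PEAG): start from $x^0\in\mathbb{R}^p$, an arbitrary $\xi^0\in Tx^0$, and $y^{-1}:=x^0$. For each $k\ge0$, $$\begin{aligned} y^k&:=x^k+\tau_k(x^0-x^k)-(\hat\eta_k-\beta_k)(Fy^{k-1}+\xi^k),\\ x^{k+1}&:=x^k+\tau_k(x^0-x^k)-\eta(Fy^k+\xi^{k+1})+\beta_k(Fy^{k-1}+\xi^k), \end{aligned}$$ where $\xi^{k+1}\in Tx^{k+1}$. The second line is implicit in $x^{k+1}$; with $\hat w^k:=Fy^{k-1}+\xi^k$ it is equivalent to $x^{k+1}\in J_{\eta T}\big(y^k-\eta Fy^k+\hat\eta_k\hat w^k\big)$ and $\hat w^{k+1}:=\frac1\eta\big(y^k-x^{k+1}+\hat\eta_k\hat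 w^k\big)$, i.e. $\xi^{k+1}=\hat w^{k+1}-Fy^k$. The iterates are assumed to exist. The $\xi^k$ in the claim are those of the scheme. *)

(* Defs.v *)
From HB Require Import structures.
From mathcomp Require Import all_boot all_order all_algebra.
From mathcomp Require Import all_classical all_reals topology normedtype.
Set Implicit Arguments.
Unset Strict Implicit.
Unset Printing Implicit Defensive.
Import Order.TTheory GRing.Theory Num.Theory.
Local Open Scope classical_set_scope.
Local Open Scope ring_scope.

Section Operators.
Context {R : realType} {p : nat}.
Local Notation V := 'rV[R]_p.
Implicit Types (F : V -> V) (G T : V -> set V) (J : V -> set V).

Definition inner (u v : V) : R := \sum_(i < p) u 0 i * v 0 i.

(* The norm `|u| of the library is the sup norm on row vectors, hence this
   separate Euclidean norm. *)
Definition enorm (u : V) : R := Num.sqrt (inner u u).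

Definition lipschitz_with (L : R) F :=
  forall x y, enorm (F x - F y) <= L * enorm (x - y).

Definition add_op F T : V -> set V := fun x => [set F x + v | v in T x].

Definition zer G : set V := [set x | G x 0].

Definition cohypomonotone (rho : R) G :=
  forall x y u v, G x u -> G y v ->
    - rho * enorm (u - v) ^+ 2 <= inner (u - v) (x - y).

Definition resolvent (eta : R) T : V -> set V :=
  fun u => [set x | [set x + eta *: v | v in T x] u].

Definition nonexpansive J :=
  exists2 j : V -> V, (forall u, J u = [set j u]) & lipschitz_with 1 j.

(* [xget 0] selects the unique element of the resolvent when the latter is
   single-valued; otherwise the value carries no meaning. *)
Definition residual (eta : R) F T (x : V) : V :=
  eta^-1 *: (x - xget 0 (resolvent eta T (x - eta *: F x))).

(* [yprev x y k] is y^{k-1}, with y^{-1} = x^0. *)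
Definition yprev (x y : nat -> V) (k : nat) : V :=
  if k is k'.+1 then y k' else x 0%N.

Definition is_PEAG F T (eta : R) (tau beta etahat : nat -> R)
    (x y xi : nat -> V) : Prop :=
  [/\ forall k, T (x k) (xi k),
      forall k, y k = x k + tau k *: (x 0%N - x k)
                  - (etahat k - beta k) *: (F (yprev x y k) + xi k)
    & forall k, x k.+1 = x k + tau k *: (x 0%N - x k)
                  - eta *: (F (y k) + xi k.+1)
                  + beta k *: (F (yprev x y k) + xi k)].

End Operators.

(* Main.v *)
Require Import Defs.
From HB Require Import structures.
From mathcomp Require Import all_boot all_order all_algebra.
From mathcomp Require Import all_classical all_reals topology normedtype.
From mathcomp Require Import ring lra.
Set Implicit Arguments.
Unset Strict Implicit.
Unset Printing Implicit Defensive.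
Import Order.TTheory GRing.Theory Num.Theory.
Local Open Scope classical_set_scope.
Local Open Scope ring_scope.

(** Write [w^k = F x^k + xi^k] and [v^k = F y^{k-1} + xi^k], and rescale by
    [t = k + 1]: [W = t w^k], [V = t v^k], with primes for the next index.
    In these variables the scheme reads
    [(t + 1) (x^{k+1} - x^0) = t (x^k - x^0) - (eta V' - s V)], where
    [s = 4 rho (t + 1) / (t + 2)], and
    [(t + 1) (x^{k+1} - y^k) = - eta (V' - V)].  The second identity, the
    Lipschitz bound and [L^2 eta^2 = 2/17] give
    [|W' - V'|^2 <= 2/17 |V' - V|^2].

    The potential is
    [a_t |W|^2 + <W, x^k - x^0> + 12/5 eta |W - V|^2], with
    [a_t = (eta - s)/2 + rho/t].  Co-hypomonotonicity between [x^k] and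
    [x^{k+1}] bounds the decrease of [<W, x^k - x^0>] from below
    ([anchored_progress]); its defect, multiplied by [t (t + 1)], is
    [rho |W' - W|^2] up to the telescoping term [rho/t |W|^2] of the weight.
    What is left is a quadratic form in [W' - W], [W - V] and [W' - V'],
    nonnegative by the Lipschitz bound ([error_form_ge0]), so the potential is
    nonincreasing ([lyapunov_step]).

    Co-hypomonotonicity between [x^k] and a zero bounds the potential below by
    [(eta - 4 rho)/2 |W|^2 - <W, x^0 - xstar>] ([lyapunov_lower]).  Initially
    it is [(eta/2 - rho/3) |w^0|^2], and Young's inequality concludes
    ([sqr_le_of_young]).  The residual is no larger than [w^k], because [x^k]
    is itself the resolvent of [x^k + eta xi^k] ([residual_le]). *)

(** * The Euclidean inner product *)

Lemma innerC (R : realType) (p : nat) (u v : 'rV[R]_p) : inner u v = inner v u.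
Proof. by apply: eq_bigr => i _; rewrite mulrC. Qed.

Lemma innerDl (R : realType) (p : nat) (u v w : 'rV[R]_p) :
  inner (u + v) w = inner u w + inner v w.
Proof. by rewrite -big_split; apply: eq_bigr => i _; rewrite mxE mulrDl. Qed.

Lemma innerZl (R : realType) (p : nat) (a : R) (u v : 'rV[R]_p) :
  inner (a *: u) v = a * inner u v.
Proof. by rewrite mulr_sumr; apply: eq_bigr => i _; rewrite mxE mulrA. Qed.

Lemma innerDr (R : realType) (p : nat) (u v w : 'rV[R]_p) :
  inner w (u + v) = inner w u + inner w v.
Proof. by rewrite innerC innerDl !(innerC w). Qed.

Lemma innerZr (R : realType) (p : nat) (a : R) (u v : 'rV[R]_p) :
  inner v (a *: u) = a * inner v u.
Proof. by rewrite innerC innerZl innerC. Qed.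

Lemma innerNl (R : realType) (p : nat) (u v : 'rV[R]_p) :
  inner (- u) v = - inner u v.
Proof. by rewrite -scaleN1r innerZl mulN1r. Qed.

Lemma innerNr (R : realType) (p : nat) (u v : 'rV[R]_p) :
  inner v (- u) = - inner v u.
Proof. by rewrite innerC innerNl innerC. Qed.

Lemma inner0r (R : realType) (p : nat) (u : 'rV[R]_p) : inner u 0 = 0.
Proof. by rewrite -(scale0r 0) innerZr mul0r. Qed.

Definition innerE := (innerDl, innerDr, innerNl, innerNr, innerZl, innerZr).

Lemma inner_ge0 (R : realType) (p : nat) (u : 'rV[R]_p) : 0 <= inner u u.
Proof. by apply: sumr_ge0 => i _; rewrite -expr2 sqr_ge0. Qed.

Lemma sqr_enorm (R : realType) (p : nat) (u : 'rV[R]_p) :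
  enorm u ^+ 2 = inner u u.
Proof. by rewrite sqr_sqrtr // inner_ge0. Qed.

Lemma lipschitz_sqr (R : realType) (p : nat) (L : R) (F : 'rV[R]_p -> 'rV[R]_p)
    (u v : 'rV[R]_p) :
  0 <= L -> lipschitz_with L F ->
  inner (F u - F v) (F u - F v) <= L ^+ 2 * inner (u - v) (u - v).
Proof.
move=> L_ge0 F_lip; rewrite -!sqr_enorm -exprMn.
by rewrite lerXn2r ?nnegrE ?mulr_ge0 ?sqrtr_ge0.
Qed.

(** * The residual operator *)

(** A single-valued resolvent [J] satisfies [u = J (u + eta v)] for [v] in [T u], so
    [eta] times the residual is a difference of two values of [J] taken at
    points whose difference is [eta (F u + v)]. *)
Lemma residual_le (R : realType) (p : nat) (F : 'rV[R]_p -> 'rV[R]_p)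
    (T : 'rV[R]_p -> set 'rV[R]_p) (eta : R) (u v : 'rV[R]_p) :
  0 < eta -> nonexpansive (resolvent eta T) -> T u v ->
  enorm (residual eta F T u) ^+ 2 <= enorm (F u + v) ^+ 2.
Proof.
move=> eta_gt0 [j jE j_lip] Tuv.
have ju : j (u + eta *: v) = u.
  have : resolvent eta T (u + eta *: v) u by exists v.
  by rewrite jE.
rewrite /residual jE (@xget_unique _ _ _ (j (u - eta *: F u))) //.
have := lipschitz_sqr (u + eta *: v) (u - eta *: F u) ler01 j_lip.
rewrite !sqr_enorm ju innerZl innerZr.
have -> : u + eta *: v - (u - eta *: F u) = eta *: (F u + v).
  by apply/rowP => i; rewrite !mxE; ring.
rewrite expr1n mul1r [X in _ <= X]innerZl innerZr => H.
by rewrite ler_pdivrMl // ler_pdivrMl.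
Qed.

(** * The potential function *)

(** With [t = k + 1] this is [(t + 1) beta_k / t], the coefficient of the
    previous direction after rescaling. *)
Definition drift (R : realType) (rho t : R) : R := 4 * rho * (t + 1) / (t + 2).

Definition weight (R : realType) (eta rho t : R) : R :=
  (eta - drift rho t) / 2 + rho / t.

(** The arguments are the rescaled quantities: [W = t w^k], [E = W - t v^k],
    [z = x^k - x^0].  The constant 12/5 is one for which the quadratic form of
    [error_form_ge0] is nonnegative for every drift between [2 rho] and [eta]. *)
Definition lyapunov (R : realType) (p : nat) (eta rho t : R)
    (W E z : 'rV[R]_p) : R :=
  weight eta rho t * inner W W + inner W z + 12 / 5 * eta * inner E E.

Lemma drift_bounds (R : realType) (rho t : R) : 0 <= rho -> 1 <= t ->
  2 * rho <= drift rho t <= 4 * rho.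
Proof.
move=> rho_ge0 t_ge1; rewrite /drift.
by apply/andP; split; rewrite ?ler_pdivlMr ?ler_pdivrMr; nra.
Qed.

(** The drift increases with [t], so replacing [t + 1] by [t] inside it can
    only enlarge the weight; the right-hand side is what the one-step estimate
    provides. *)
Lemma weight_succ (R : realType) (eta rho t : R) : 0 <= rho -> 1 <= t ->
  weight eta rho (t + 1) <= (eta - drift rho t) / 2 + rho / (t + 1).
Proof.
move=> rho_ge0 t_ge1; rewrite /weight lerD2r ler_pM2r ?invr_gt0 //.
rewrite lerD2l lerN2 /drift ler_pdivlMr; last by lra.
by rewrite mulrAC ler_pdivrMr; nra.
Qed.

(** * The potential is nonincreasing *)

(** The inequality assumed is co-hypomonotonicity at two consecutive iterates.
    Multiplying it by [t (t + 1)] and eliminating [z' - z] through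
    [t (z' - z) = - z' - U] and [(t + 1) (z' - z) = - z - U] makes the inner
    products with [z] and [z'] telescope.  The defect splits as
    [|t W' - (t + 1) W|^2 / (t (t + 1)) =
     |W' - W|^2 - |W'|^2 / (t + 1) + |W|^2 / t]. *)
Lemma anchored_progress (R : realType) (p : nat) (rho t : R)
    (W W' U z z' : 'rV[R]_p) :
  0 < t -> (t + 1) *: z' = t *: z - U ->
  - rho * inner ((t + 1)^-1 *: W' - t^-1 *: W) ((t + 1)^-1 *: W' - t^-1 *: W)
    <= inner ((t + 1)^-1 *: W' - t^-1 *: W) (z' - z) ->
  inner (W' - W) U - rho * inner (W' - W) (W' - W)
    + rho / (t + 1) * inner W' W' - rho / t * inner W W
    <= inner W z - inner W' z'.
Proof.
move=> t_gt0 z'E; have t1_gt0 : 0 < t + 1 by lra.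
have -> : U = t *: z - (t + 1) *: z'.
  by rewrite z'E; apply/rowP => i; rewrite !mxE; ring.
move=> H; have := ler_wpM2l (ltW (mulr_gt0 t_gt0 t1_gt0)) H.
rewrite !innerE (innerC W W') -subr_ge0 => {}H; rewrite -subr_ge0.
apply: le_trans H _; rewrite le_eqVlt; apply/orP; left; apply/eqP; field.
by rewrite !gt_eqF.
Qed.

(** With [P = W' - W] the vector [P + E - E'] is [V' - V].  With [q = s / eta]
    in [0, 1], the form is [(s - 2 rho)/2 |P|^2], plus [17/5 eta] times the slack
    of the Lipschitz bound, plus [eta] times
    [1/10 |P - E' + (5 q - 4) E|^2 + 1/2 |E' + q E|^2
     + (2/5 + 4 q - 3 q^2) |E|^2], whose last coefficient is positive. *)
Lemma error_form_ge0 (R : realType) (p : nat) (eta rho s : R)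
    (P E E' : 'rV[R]_p) :
  0 < eta -> 2 * rho <= s -> 0 <= s -> s <= eta ->
  inner E' E' <= 2 / 17 * inner (P + E - E') (P + E - E') ->
  0 <= (eta + s - 2 * rho) / 2 * inner P P - eta * inner P E' + s * inner P E
       + 12 / 5 * eta * (inner E E - inner E' E').
Proof.
move=> eta_gt0 rho_s s_ge0 s_eta lip.
have [q sE] : exists q, s = eta * q.
  by exists (s / eta); rewrite mulrC divfK // gt_eqF.
have q_ge0 : 0 <= q by rewrite sE pmulr_rge0 in s_ge0.
have q_le1 : q <= 1 by move: s_eta; rewrite sE ger_pMr.
set S1 := P - E' + (5 * q - 4) *: E; set S2 := E' + q *: E.
set lin := 2 / 17 * inner (P + E - E') (P + E - E') - inner E' E'.
have squares_ge0 : 0 <= eta * (1 / 10 * inner S1 S1 + 1 / 2 * inner S2 S2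
    + (2 / 5 + 4 * q - 3 * q ^+ 2) * inner E E + 17 / 5 * lin).
  have q_coef : 0 <= (2 / 5 + 4 * q - 3 * q ^+ 2) * inner E E.
    by apply: mulr_ge0; [nra | exact: inner_ge0].
  have lin_ge0 : 0 <= lin by rewrite subr_ge0.
  have := inner_ge0 S1; have := inner_ge0 S2 => S2_ge0 S1_ge0.
  by apply: mulr_ge0; [exact: ltW | lra].
have P_ge0 : 0 <= (s - 2 * rho) / 2 * inner P P.
  by apply: mulr_ge0; [lra | exact: inner_ge0].
have := addr_ge0 P_ge0 squares_ge0; congr (0 <= _); rewrite /S1 /S2 /lin.
rewrite !innerE (innerC E P) (innerC E' P) (innerC E E') sE.
by field.
Qed.

(** The last three hypotheses are the update of [x^k], co-hypomonotonicity at
    consecutive iterates, and the Lipschitz bound, in rescaled variables. *)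
Lemma lyapunov_step (R : realType) (p : nat) (eta rho t : R)
    (W W' V V' z z' : 'rV[R]_p) :
  0 < eta -> 0 <= rho -> 4 * rho < eta -> 1 <= t ->
  (t + 1) *: z' = t *: z - (eta *: V' - drift rho t *: V) ->
  - rho * inner ((t + 1)^-1 *: W' - t^-1 *: W) ((t + 1)^-1 *: W' - t^-1 *: W)
    <= inner ((t + 1)^-1 *: W' - t^-1 *: W) (z' - z) ->
  inner (W' - V') (W' - V') <= 2 / 17 * inner (V' - V) (V' - V) ->
  lyapunov eta rho (t + 1) W' (W' - V') z' <= lyapunov eta rho t W (W - V) z.
Proof.
move=> eta_gt0 rho_ge0 rho_eta t_ge1 z'E cohypo lip.
have /andP[s_ge s_le] := drift_bounds rho_ge0 t_ge1.
have t_gt0 : 0 < t by lra.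
have progress := anchored_progress t_gt0 z'E cohypo.
have W'_le := ler_wpM2r (inner_ge0 W') (weight_succ eta rho_ge0 t_ge1).
have VE : V' - V = W' - W + (W - V) - (W' - V').
  by apply/rowP => i; rewrite !mxE; ring.
rewrite VE in lip.
have := error_form_ge0 eta_gt0 s_ge _ _ lip => /(_ ltac:(lra) ltac:(lra)).
move: progress W'_le; rewrite /lyapunov [weight eta rho t]/weight.
move: (drift rho t) (weight _ _ _) => s a.
rewrite !innerE (innerC W W') (innerC V W) (innerC V' W')
  ?(innerC V' W) ?(innerC V W').
move: (rho / (t + 1)) (rho / t) => r1 r2.
lra.
Qed.

(** * From the potential to the rate *)

(** The hypothesis is co-hypomonotonicity between [x^k] and a zero [xstar], with
    [d = x^0 - xstar]; its defect cancels the term [rho / t] of the weight. *)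
Lemma lyapunov_lower (R : realType) (p : nat) (eta rho t : R)
    (W E z d : 'rV[R]_p) :
  0 < eta -> 0 <= rho -> 1 <= t ->
  - (rho / t) * inner W W <= inner W (z + d) ->
  (eta - 4 * rho) / 2 * inner W W <= lyapunov eta rho t W E z + inner W d.
Proof.
move=> eta_gt0 rho_ge0 t_ge1; rewrite innerDr => H.
have /andP[_ s_le] := drift_bounds rho_ge0 t_ge1.
have := inner_ge0 E; have := inner_ge0 W => W0 E0.
have EE := mulr_ge0 (ltW eta_gt0) E0.
have sW := ler_wpM2r W0 s_le.
by rewrite /lyapunov /weight; lra.
Qed.

Lemma sqr_le_of_young (R : realType) (p : nat) (A V : R) (W d : 'rV[R]_p) :
  0 < A -> A / 2 * inner W W <= V + inner W d ->
  inner W W <= 4 / A ^+ 2 * inner d d + 4 / A * V.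
Proof.
move=> A_gt0 H.
have A_neq0 : A != 0 by rewrite gt_eqF.
have D := inner_ge0 (A / 2 *: W - d).
have H' : A ^+ 2 / 4 * inner W W <= inner d d + A * V.
  have := ler_wpM2l (ltW A_gt0) H; move: D.
  by rewrite !innerE (innerC d W); lra.
have -> : 4 / A ^+ 2 * inner d d + 4 / A * V = 4 / A ^+ 2 * (inner d d + A * V).
  by field.
have -> : inner W W = 4 / A ^+ 2 * (A ^+ 2 / 4 * inner W W) by field.
by rewrite ler_pM2l // divr_gt0 // exprn_gt0.
Qed.

Theorem theorem5p2 (R : realType) (p : nat)
  (F : 'rV[R]_p -> 'rV[R]_p) (T : 'rV[R]_p -> set 'rV[R]_p)
  (L rho eta : R) (tau beta etahat : nat -> R)
  (x y xi : nat -> 'rV[R]_p)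
  (L_gt0 : 0 < L) (F_lip : lipschitz_with L F)
  (rho_ge0 : 0 <= rho) (FT_cohypo : cohypomonotone rho (add_op F T))
  (Lrho : 2 * Num.sqrt 34 * L * rho < 1)
  (zer_neq0 : zer (add_op F T) !=set0)
  (eta_def : eta = 1 / L * Num.sqrt (2 / 17))
  (tau_def : forall k : nat, tau k = 1 / (k + 2)%:R)
  (beta_def : forall k : nat,
     beta k = 4 * rho * (1 - tau k) / (1 + tau k))
  (etahat_def : forall k : nat, etahat k = (1 - tau k) * eta)
  (xy_PEAG : is_PEAG F T eta tau beta etahat x y xi) :
  (forall (k : nat) (xstar : 'rV[R]_p), zer (add_op F T) xstar ->
     enorm (F (x k) + xi k) ^+ 2 <=
       1 / (k + 1)%:R ^+ 2 *
       (4 / (eta - 4 * rho) ^+ 2 * enorm (x 0%N - xstar) ^+ 2 +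
        2 * (3 * eta - 2 * rho) / (3 * (eta - 4 * rho)) *
          enorm (F (x 0%N) + xi 0%N) ^+ 2)) /\
  (nonexpansive (resolvent eta T) ->
   forall (k : nat) (xstar : 'rV[R]_p), zer (add_op F T) xstar ->
     enorm (residual eta F T (x k)) ^+ 2 <=
       1 / (k + 1)%:R ^+ 2 *
       (4 / (eta - 4 * rho) ^+ 2 * enorm (x 0%N - xstar) ^+ 2 +
        2 * (3 * eta - 2 * rho) / (3 * (eta - 4 * rho)) *
          enorm (F (x 0%N) + xi 0%N) ^+ 2)).
Proof.
have eta_gt0 : 0 < eta by rewrite eta_def mulr_gt0 ?divr_gt0 // sqrtr_gt0; lra.
have eta_sqr : L ^+ 2 * eta ^+ 2 = 2 / 17.
  rewrite eta_def exprMn sqr_sqrtr; last by lra.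
  by field; rewrite gt_eqF.
have rho_eta : 4 * rho < eta.
  (* sqrt 34 * sqrt (2/17) = 2, so the bound on L rho says exactly this. *)
  have sqrt_eta : Num.sqrt 34 * (L * eta) = 2.
    rewrite eta_def div1r mulVKf ?gt_eqF // -sqrtrM //.
    have -> : 34 * (2 / 17) = 2 ^+ 2 :> R by field.
    by rewrite sqrtr_sqr gtr0_norm.
  have sL_gt0 : 0 < Num.sqrt 34 * L :> R by rewrite mulr_gt0 // sqrtr_gt0.
  by rewrite -(ltr_pM2l sL_gt0); lra.
case: xy_PEAG => xiT yE xE.
pose t k : R := k%:R + 1.
have t_ge1 k : 1 <= t k by rewrite /t lerDr.
have t_succ k : t k.+1 = t k + 1 by rewrite /t -natr1.
pose w k := F (x k) + xi k.
pose v k := F (yprev x y k) + xi k.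
have w_mem k : add_op F T (x k) (w k) by exists (xi k).
pose V k :=
  lyapunov eta rho (t k) (t k *: w k) (t k *: w k - t k *: v k) (x k - x 0%N).
have tauE k : tau k = 1 / (t k + 1) by rewrite tau_def /t natrD; congr (1 / _); lra.
have V_step k : V k.+1 <= V k.
  have t_gt0 : 0 < t k by have := t_ge1 k; lra.
  have t1_gt0 : 0 < t k + 1 by lra.
  have t2_gt0 : 0 < t k + 2 by lra.
  have betaE : beta k = 4 * rho * t k / (t k + 2).
    rewrite beta_def tauE; field.
    by rewrite !gt_eqF //; lra.
  rewrite /V t_succ; apply: lyapunov_step => //.
  - apply/rowP => i; rewrite xE /v /= betaE tauE /drift !mxE; field.
    by rewrite !gt_eqF.
  - rewrite !scalerA !mulVf ?gt_eqF // !scale1r -sqr_enorm.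
    have -> : x k.+1 - x 0%N - (x k - x 0%N) = x k.+1 - x k.
      by apply/rowP => i; rewrite !mxE; ring.
    exact: FT_cohypo.
  - have := lipschitz_sqr (x k.+1) (y k) (ltW L_gt0) F_lip.
    have -> : x k.+1 - y k =
      (- eta / (t k + 1)) *: ((t k + 1) *: v k.+1 - t k *: v k).
      rewrite xE /v [yprev x y k.+1]/=; move: (F (y k)) => Fy; rewrite yE.
      apply/rowP => i; rewrite etahat_def betaE tauE !mxE; field.
      by rewrite !gt_eqF.
    have -> : (t k + 1) *: w k.+1 - (t k + 1) *: v k.+1 =
      (t k + 1) *: (F (x k.+1) - F (y k)).
      by apply/rowP => i; rewrite !mxE /=; ring.
    rewrite -eta_sqr ![inner (_ *: _) _]innerZl ![inner _ (_ *: _)]innerZr.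
    set D := inner (F _ - _) _; set N := inner (_ - _) _ => H.
    have := ler_wpM2l (sqr_ge0 (t k + 1)) H.
    have -> : (t k + 1) ^+ 2 *
        (L ^+ 2 * (- eta / (t k + 1) * (- eta / (t k + 1) * N))) = L ^+ 2 * eta ^+ 2 * N by field; rewrite gt_eqF.
    by rewrite expr2 mulrA.
(* The drift is 8 rho / 3 at t = 1, and W = V there because y^{-1} = x^0. *)
have V_le k : V k <= (3 * eta - 2 * rho) / 6 * inner (w 0%N) (w 0%N).
  elim: k => [|k]; last exact: le_trans.
  have t0E : t 0%N = 1 by rewrite /t add0r.
  rewrite /V t0E !scale1r !subrr /lyapunov /weight /drift !inner0r.
  by rewrite le_eqVlt; apply/orP; left; apply/eqP; field.
have bound k xstar : zer (add_op F T) xstar ->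
     enorm (F (x k) + xi k) ^+ 2 <=
       1 / (k + 1)%:R ^+ 2 *
       (4 / (eta - 4 * rho) ^+ 2 * enorm (x 0%N - xstar) ^+ 2 +
        2 * (3 * eta - 2 * rho) / (3 * (eta - 4 * rho)) *
          enorm (F (x 0%N) + xi 0%N) ^+ 2).
  move=> zs; have t_gt0 : 0 < t k by have := t_ge1 k; lra.
  have A_gt0 : 0 < eta - 4 * rho by lra.
  have lower : (eta - 4 * rho) / 2 * inner (t k *: w k) (t k *: w k)
      <= V k + inner (t k *: w k) (x 0%N - xstar).
    apply: lyapunov_lower => //.
    have -> : x k - x 0%N + (x 0%N - xstar) = x k - xstar.
      by apply/rowP => i; rewrite !mxE; ring.
    have := FT_cohypo _ _ _ _ (w_mem k) zs; rewrite subr0 sqr_enorm => H.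
    rewrite !innerZl innerZr.
    have -> : - (rho / t k) * (t k * (t k * inner (w k) (w k)))
      = t k * (- rho * inner (w k) (w k)) by field; rewrite gt_eqF.
    by rewrite ler_pM2l.
  have := sqr_le_of_young A_gt0 lower.
  have := ler_wpM2l (ltW (divr_gt0 (ltr0Sn R 3) A_gt0)) (V_le k).
  rewrite !sqr_enorm innerZl innerZr -/(w k) -/(w 0%N) natrD -/(t k).
  move=> H1 H2; rewrite div1r ler_pdivlMl ?exprn_gt0 // expr2 -(mulrA (t k)).
  apply: le_trans H2 _; rewrite lerD2l; apply: le_trans H1 _.
  rewrite le_eqVlt; apply/orP; left; apply/eqP; field.
  by rewrite gt_eqF.
split=> // J_nonexp k xstar zs.
exact: le_trans (residual_le F eta_gt0 J_nonexp (xiT k)) (bound k xstar zs).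
Qed.
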